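(* Let $n>2$. A pentagonal quasigroup induced by the group $\mathbb{Z}_n$ has one of the following forms: $$x\cdot y=[ax+(1-a)y]_n,$$ $$x\cdot y=[-a^2x+(1+a^2)y]_n,$$ $$x\cdot y=[a^3x+(1-a^3)y]_n,$$ $$x\cdot y=[-a^4x+(1+a^4)y]_n,$$ where $1<a<n-1$ is an integer satisfying $[a^4-a^3+a^2-a+1]_n=0$ and $\gcd(a,n)=\gcd(a-1,n)=1$; except for the case $a=n-1$, in which there is only one pentagonal quasigroup: it is induced by $\mathbb{Z}_5$ and has the form $x\cdot y=[4x+2y]_5$.
   Context: $[z]_n$ denotes the residue of the integer $z$ modulo $n$ (with $0$ and $n$ identified), so $[u]_n=[v]_n$ means $u\equiv v\pmod n$. A pentagonal quasigroup is a quasigroup satisfying $xx=x$, $\;(xy)(zu)=(xz)(yu)$ and $\big(((xy)x)y\big)x=y$. An Abelian group $(Q,+)$ induces the pentagonal quasigroup $(Q,\cdot)$ if $x\cdot y=\varphi(x)+y-\varphi(y)$ for all $x,y\in Q$, where $\varphi$ is a regular automorphism of $(Q,+)$ (i.e. $\varphi(x)=x$ only for $x=0$) satisfying $\varphi^4-\varphi^3+\varphi^2-\varphi+\varepsilon=0$, with $\varepsilon$ the identity map. For $(Q,+)=\mathbb{Z}_n$ such a $\varphi$ is of the form $\varphi(x)=[ax]_n$. ''The case $a=n-1$'' refers to a pentagonal quasigroup induced by $\mathbb{Z}_n$ through the automorphism $\varphi(x)=[(n-1)x]_n=[-x]_n$. *)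

(* Defs.v *)
From HB Require Import structures.
From mathcomp Require Import all_boot all_order all_algebra.

Set Implicit Arguments.
Unset Strict Implicit.
Unset Printing Implicit Defensive.

Import Order.TTheory GRing.Theory Num.Theory.
Local Open Scope ring_scope.

Definition quasigroup (Q : Type) (mul : Q -> Q -> Q) : Prop :=
  (forall a b : Q, exists! x : Q, mul a x = b) /\
  (forall a b : Q, exists! y : Q, mul y a = b).

Definition pentagonal_quasigroup (Q : Type) (mul : Q -> Q -> Q) : Prop :=
  [/\ quasigroup mul,
      forall x : Q, mul x x = x,
      forall x y z u : Q,
        mul (mul x y) (mul z u) = mul (mul x z) (mul y u)
    & forall x y : Q, mul (mul (mul (mul x y) x) y) x = y].

Definition automorphism (Q : zmodType) (phi : Q -> Q) : Prop :=
  {morph phi : x y / x + y} /\ bijective phi.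

Definition regular_automorphism (Q : zmodType) (phi : Q -> Q) : Prop :=
  automorphism phi /\ (forall x : Q, phi x = x -> x = 0).

Definition induces (Q : zmodType) (phi : Q -> Q) (mul : Q -> Q -> Q) : Prop :=
  [/\ regular_automorphism phi,
      forall x : Q, iter 4 phi x - iter 3 phi x + iter 2 phi x - phi x + x = 0
    & forall x y : Q, mul x y = phi x + y - phi y].

Definition induced_pentagonal_quasigroup
    (Q : zmodType) (phi : Q -> Q) (mul : Q -> Q -> Q) : Prop :=
  pentagonal_quasigroup mul /\ induces phi mul.

Definition admissible (n : nat) (a : int) : Prop :=
  [/\ 1 < a < n%:Z - 1,
      (a ^+ 4 - a ^+ 3 + a ^+ 2 - a + 1 = 0 %[mod n%:Z])%Z,
      gcdz a n%:Z = 1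
    & gcdz (a - 1) n%:Z = 1].

(* For x, y in 'Z_n and integers b, c, the element [b x + c y]_n of 'Z_n;
   the cast b%:~R is reduction modulo n, as 'Z_n is Z/nZ when n > 1. *)
Definition residue_form (n : nat) (b c : int) (x y : 'Z_n) : 'Z_n :=
  b%:~R * x + c%:~R * y.

Definition one_of_four_forms
    (n : nat) (a : int) (mul : 'Z_n -> 'Z_n -> 'Z_n) : Prop :=
  [\/ forall x y : 'Z_n, mul x y = residue_form a (1 - a) x y,
      forall x y : 'Z_n, mul x y = residue_form (- a ^+ 2) (1 + a ^+ 2) x y,
      forall x y : 'Z_n, mul x y = residue_form (a ^+ 3) (1 - a ^+ 3) x y
    | forall x y : 'Z_n, mul x y = residue_form (- a ^+ 4) (1 + a ^+ 4) x y].

(* Main.v *)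
Require Import Defs.
From HB Require Import structures.
From mathcomp Require Import all_boot all_order all_algebra.
From mathcomp Require Import ring zify.

Set Implicit Arguments.
Unset Strict Implicit.
Unset Printing Implicit Defensive.

Import Order.TTheory GRing.Theory Num.Theory.
Local Open Scope ring_scope.

(** The condition on the inducing automorphism says that its multiplier is a
    root of the tenth cyclotomic polynomial
    Phi10 = X^4 - X^3 + X^2 - X + 1.

    An additive map of Z/nZ is multiplication by its value c at 1, and the
    operation it induces is then c x + (1 - c) y.  For every root c of Phi10
    both c and 1 - c are invertible, because
      1 - Phi10(c) = c (1 - c + c^2 - c^3) = (1 - c) (c^3 + c);
    hence any root yields a regular automorphism and a quasigroup
    ([Phi10_root_induces]).  Conversely, the multiplier c of an inducing
    automorphism is a root ([induces_Phi10]), and the same identities, read in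
    the integers, make its representative a in [0, n) prime to n, as is a - 1
    ([admissible_root]).  As 0 and 1 are not roots and n - 1 is set apart,
    1 < a < n - 1, and c x + (1 - c) y is the first of the four forms.

    All four forms occur because the roots of Phi10 behave like primitive
    tenth roots of unity: with c also c^3, c^7 = - c^2 and c^9 = - c^4 are
    roots.  In any commutative ring this follows from Phi10(X) dividing
    Phi10(- X^2) and Phi10(X^3).

    Finally, Phi10(-1) = 5, so the multiplier n - 1, that is -1, is a root
    exactly when n divides 5, and n = 5 is the only such n above 2. *)

Definition Phi10 (R : pzRingType) (c : R) : R :=
  c ^+ 4 - c ^+ 3 + c ^+ 2 - c + 1.

Section RootsOfPhi10.
Variable R : comPzRingType.
Implicit Types b c x y : R.

(** The cofactor is the fifth cyclotomic polynomial: Phi10(- X^2) = Phi5(X^2)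
    and Phi5(X^2) = Phi5(X) Phi10(X). *)
Lemma Phi10_Nsqr c : Phi10 c = 0 -> Phi10 (- c ^+ 2) = 0.
Proof.
rewrite /Phi10 => c0.
transitivity ((c ^+ 4 - c ^+ 3 + c ^+ 2 - c + 1)
  * (c ^+ 4 + c ^+ 3 + c ^+ 2 + c + 1)); first by ring.
by rewrite c0 mul0r.
Qed.

(** The cofactor is the thirtieth cyclotomic polynomial:
    Phi10(X^3) = Phi10(X) Phi30(X). *)
Lemma Phi10_cube c : Phi10 c = 0 -> Phi10 (c ^+ 3) = 0.
Proof.
rewrite /Phi10 => c0.
transitivity ((c ^+ 4 - c ^+ 3 + c ^+ 2 - c + 1)
  * (c ^+ 8 + c ^+ 7 - c ^+ 5 - c ^+ 4 - c ^+ 3 + c + 1)); first by ring.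
by rewrite c0 mul0r.
Qed.

Lemma Phi10_Nexp4 c : Phi10 c = 0 -> Phi10 (- c ^+ 4) = 0.
Proof.
have -> : - c ^+ 4 = - (- c ^+ 2) ^+ 2 by ring.
by move=> c0; do 2!apply: Phi10_Nsqr.
Qed.

Lemma Phi10_root_inv c : Phi10 c = 0 -> (1 - c + c ^+ 2 - c ^+ 3) * c = 1.
Proof.
rewrite /Phi10 => c0; apply/eqP; rewrite -subr_eq0 -oppr0 -c0.
by apply/eqP; ring.
Qed.

Lemma Phi10_root_subr_inv c : Phi10 c = 0 -> (c ^+ 3 + c) * (1 - c) = 1.
Proof.
rewrite /Phi10 => c0; apply/eqP; rewrite -subr_eq0 -oppr0 -c0.
by apply/eqP; ring.
Qed.

Lemma linear_quasigroup b c b' c' (mul : R -> R -> R) :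
    b' * b = 1 -> c' * c = 1 -> (forall x y, mul x y = b * x + c * y) ->
  quasigroup mul.
Proof.
move=> b1 c1 mulE; split=> u v.
  exists (c' * (v - b * u)); split=> [|x].
    by rewrite mulE mulrA [c * c']mulrC c1 mul1r addrC subrK.
  by rewrite mulE => <-; rewrite addrC addKr mulrA c1 mul1r.
exists (b' * (v - c * u)); split=> [|x].
  by rewrite mulE mulrA [b * b']mulrC b1 mul1r subrK.
by rewrite mulE => <-; rewrite addrK mulrA b1 mul1r.
Qed.

(** In (((x y) x) y) x the coefficient of y is (1 - c) (c^3 + c), which is 1 at
    a root; by idempotence the coefficients sum to 1, so x cancels.  Mediality
    and idempotence hold for every c.  Regularity follows from 1 - c being
    invertible. *)
Lemma Phi10_root_induces c (mul : R -> R -> R) :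
    Phi10 c = 0 -> (forall x y, mul x y = c * x + (1 - c) * y) ->
  induced_pentagonal_quasigroup ( *%R c) mul.
Proof.
move=> c0 mulE.
have cV := Phi10_root_inv c0; have cBV := Phi10_root_subr_inv c0.
split.
  split; first exact: linear_quasigroup cV cBV mulE.
  - by move=> x; rewrite mulE; ring.
  - by move=> x y z u; rewrite !mulE; ring.
  move=> x y; rewrite !mulE.
  (* The coefficient of x is one minus that of y. *)
  transitivity (x - (c ^+ 3 + c) * (1 - c) * x + (c ^+ 3 + c) * (1 - c) * y).
    by ring.
  by rewrite cBV !mul1r subrr add0r.
split.
- split; first split.
  + by move=> x y; rewrite mulrDr.
  + exists ( *%R (1 - c + c ^+ 2 - c ^+ 3)) => x; rewrite mulrA.
      by rewrite cV mul1r.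
    by rewrite mulrC [c * _]mulrC cV mulr1.
  + move=> x cx.
    by rewrite -[x]mul1r -cBV -mulrA mulrBl mul1r cx subrr mulr0.
- move=> x /=; transitivity (Phi10 c * x); first by rewrite /Phi10; ring.
  by rewrite c0 mul0r.
- by move=> x y; rewrite mulE; ring.
Qed.

End RootsOfPhi10.

Lemma rmorph_Phi10 (R S : pzRingType) (f : {rmorphism R -> S}) (c : R) :
  f (Phi10 c) = Phi10 (f c).
Proof. by rewrite /Phi10 rmorphD rmorph1 rmorphB rmorphD rmorphB !rmorphXn. Qed.

Lemma intr_Zp_eq0 n (k : int) : (1 < n)%N ->
  (k%:~R == 0 :> 'Z_n) = (n%:Z %| k)%Z.
Proof.
move=> n1.
have nat0 (m : nat) : (m%:R == 0 :> 'Z_n) = (n %| m)%N.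
  by rewrite -val_eqE /= val_Zp_nat.
case: k => m; first by rewrite -pmulrn nat0.
by rewrite NegzE rmorphN /= oppr_eq0 dvdzE abszN -pmulrn nat0.
Qed.

(** The additive group is generated by 1. *)
Lemma Zp_morph_mul n (phi : 'Z_n -> 'Z_n) :
  {morph phi : x y / x + y} -> forall x, phi x = phi 1 * x.
Proof.
move=> phiD x; rewrite -{1}[x]natr_Zp -{2}[x]natr_Zp mulr_natr.
have phi0 : phi 0 = 0 by apply: (addrI (phi 0)); rewrite -phiD !addr0.
by elim: (nat_of_ord x) => [|m IHm]; rewrite ?phi0 // !mulrS phiD IHm.
Qed.

Lemma intr_order_Bn1 n : (1 < n)%N -> (n%:Z - 1)%:~R = - 1 :> 'Z_n.
Proof.
move=> n1; rewrite rmorphB /= (_ : n%:~R = 0) ?sub0r //.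
by apply/eqP; rewrite intr_Zp_eq0 // dvdzz.
Qed.

Lemma induces_Phi10 n (phi : 'Z_n -> 'Z_n) mul : induces phi mul ->
  [/\ forall x, phi x = phi 1 * x, Phi10 (phi 1) = 0
    & forall x y, mul x y = phi 1 * x + (1 - phi 1) * y].
Proof.
move=> [[[/Zp_morph_mul phiE _] _] phiP mulE]; split=> //.
  by rewrite -[RHS](phiP 1) /= !(phiE (phi _)) /Phi10; ring.
by move=> x y; rewrite mulE !(phiE x) !(phiE y); ring.
Qed.

(** Both coprimality conditions are consequences of the congruence: the
    identities making c and 1 - c invertible at a root give, over the integers,
    Bezout relations of a and a - 1 with n. *)
Lemma admissible_root n (a : int) : (1 < a < n%:Z - 1) ->
  (n%:Z %| Phi10 a)%Z -> admissible n a.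
Proof.
move=> a_bd n_a; split=> //.
- by apply/eqP; rewrite eqz_mod_dvd subr0.
- apply/eqP/coprimezP; case/dvdzP: n_a => q; rewrite /Phi10 => qE.
  exists (1 - a + a ^+ 2 - a ^+ 3, q) => /=; rewrite -qE; ring.
- apply/eqP/coprimezP; case/dvdzP: n_a => q; rewrite /Phi10 => qE.
  exists (- (a ^+ 3 + a), q) => /=; rewrite -qE; ring.
Qed.

Theorem theorem3p3 (n : nat) (n_gt2 : (2 < n)%N)
    (mul : 'Z_n -> 'Z_n -> 'Z_n) :
  [/\ (forall phi : 'Z_n -> 'Z_n,
         induced_pentagonal_quasigroup phi mul ->
         ~ (forall x : 'Z_n, phi x = (n%:Z - 1)%:~R * x) ->
         exists a : int, admissible n a /\ one_of_four_forms a mul),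
      (forall a : int, admissible n a -> one_of_four_forms a mul ->
         exists phi : 'Z_n -> 'Z_n, induced_pentagonal_quasigroup phi mul)
    & (exists phi : 'Z_n -> 'Z_n,
         induced_pentagonal_quasigroup phi mul /\
         (forall x : 'Z_n, phi x = (n%:Z - 1)%:~R * x))
      <-> (n = 5%N /\ forall x y : 'Z_n, mul x y = residue_form 4 2 x y)].
Proof.
have n_gt1 : (1 < n)%N by exact: ltnW.
split.
- move=> phi [_ /induces_Phi10[phiE c0 mulE]] phiN.
  (* a is the representative in [0, n) of the multiplier phi 1. *)
  pose k : nat := phi 1; pose a := k%:Z.
  have c1 : phi 1 = a%:~R by rewrite -pmulrn natr_Zp.
  have a0 : (n%:Z %| Phi10 a)%Z.
    by rewrite -intr_Zp_eq0 // rmorph_Phi10 /= -c1 c0.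
  exists a; split; last first.
    by apply: Or41 => x y; rewrite mulE /residue_form rmorphB /= -c1.
  apply: admissible_root => //.
  have lt_n : (k < n)%N 
    by have := ltn_ord (phi 1); rewrite [X in (_ < X)%N -> _]Zp_cast.
  have ne_nB1 : a <> n%:Z - 1.
    by move=> E; apply: phiN => x; rewrite phiE {1}c1 E.
  have ne0 : k <> 0%N.
    move=> E; move/eqP: c0; rewrite c1 /a E /Phi10 /= !expr0n /= !(subr0, add0r).
    by rewrite oner_eq0.
  have ne1 : k <> 1%N.
    move=> E; move/eqP: c0; rewrite c1 /a E /Phi10 /= !expr1n subrr add0r subrr.
    by rewrite add0r oner_eq0.
  by rewrite /a; lia.
- move=> a [_ /eqP] + _ _; rewrite eqz_mod_dvd subr0 -intr_Zp_eq0 // => /eqP.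
  rewrite -/(Phi10 a) rmorph_Phi10 /= => a0.
  (* Each form is b x + (1 - b) y for a root b of Phi10 derived from a. *)
  have root_form (b c : int) : Phi10 (b%:~R : 'Z_n) = 0 -> c = 1 - b ->
      (forall x y, mul x y = residue_form b c x y) ->
      exists phi : 'Z_n -> 'Z_n, induced_pentagonal_quasigroup phi mul.
    move=> b0 -> mulE; exists ( *%R b%:~R); apply: Phi10_root_induces b0 _.
    by move=> x y; rewrite mulE /residue_form rmorphB.
  case; apply: root_form; rewrite ?opprK // ?rmorphN !rmorphXn /=.
  + exact: Phi10_Nsqr.
  + exact: Phi10_cube.
  + exact: Phi10_Nexp4.
- split=> [[phi [[_ /induces_Phi10[_ c0 mulE]] phiN]]|].
    have c1 : phi 1 = -1 by rewrite phiN intr_order_Bn1 // mulr1.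
    (* Phi10 (-1) = 5. *)
    have n5 : n = 5%N.
      have : (n%:Z %| 5)%Z.
        rewrite -intr_Zp_eq0 //; apply/eqP; rewrite -c0 c1 /Phi10; ring.
      rewrite dvdzE /= => /(primeP (isT : prime 5)).2; lia.
    split=> // x y; rewrite mulE c1 /residue_form.
    have -> : 4%:~R = -1 :> 'Z_n by rewrite -intr_order_Bn1 // n5.
    by ring.
  move=> [n5 mulE]; exists ( *%R (n%:Z - 1)%:~R); split=> //.
  apply: Phi10_root_induces => [|x y]; rewrite intr_order_Bn1 //.
    rewrite (_ : Phi10 _ = 5%:~R); last by rewrite /Phi10; ring.
    by apply/eqP; rewrite intr_Zp_eq0 // n5.
  rewrite mulE /residue_form.
  have -> : 4%:~R = -1 :> 'Z_n by rewrite -intr_order_Bn1 // n5.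
  by ring.
Qed.
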